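(* Let $q$ be a primitive integral isotropic ternary quadratic form with $\Delta=\Delta(q)>0$. Then there is a positive integer $K\le\tau(\Delta)$ and there are nonsingular $3\times 3$ integer matrices $M_1,\ldots,M_K$ with the following properties. (i) If $\Delta$ is square-free then $K=\tau(\Delta)$. (ii) For each $k$, $\det(M_k)$ is a positive divisor of $\Delta$. (iii) For every primitive integral solution $\mathbf{x}\in\mathbb{Z}^3$ of $q(\mathbf{x})=0$ there is a unique index $k$ such that $\mathbf{x}\in M_k(\mathbb{Z}^3)$. (iv) For each $k$ there is $D_k\in\mathbb{N}$ such that $q(M_k\mathbf{x})=D_k(x_1x_3-x_2^2)$ identically in $\mathbf{x}$. (v) $\Delta\det(M_k)^2=D_k^3$, so that $D_k\mid\Delta$ and $\det(M_k)\mid D_k$; moreover $D_k\mid\det(M_k)^2$. (vi) A prime $p$ can divide $\Delta\det(M_k)^{-1}$ only if $v_p(\Delta)\ge 4$. (vii) If $\Delta$ is cube-free then for every index $k\le\tau(\Delta)$ the set $M_k(\mathbb{Z}^3)$ contains a primitive integer zero of $q$.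
   Context: A ternary quadratic form $q(\mathbf{x})=\sum_{1\le i\le j\le 3}q_{ij}x_ix_j$ is integral if all $q_{ij}\in\mathbb{Z}$, primitive if $\gcd(q_{ij})=1$, and isotropic if $q(\mathbf{x})=0$ has a nonzero integer solution. Its matrix is $Q=\begin{pmatrix}2q_{11}&q_{12}&q_{13}\\ q_{12}&2q_{22}&q_{23}\\ q_{13}&q_{23}&2q_{33}\end{pmatrix}$ and its determinant is defined as $\Delta(q)=\tfrac12\det(Q)\in\mathbb{Z}$. An integer vector is primitive if its entries have no common factor greater than 1. $\tau$ denotes the number of positive divisors and $v_p$ the $p$-adic valuation. *)

(* Defs.v *)
From HB Require Import structures.
From mathcomp Require Import all_boot all_order all_algebra.
From mathcomp Require Import ring.

Set Implicit Arguments.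
Unset Strict Implicit.
Unset Printing Implicit Defensive.

Import Order.TTheory GRing.Theory Num.Theory.
Local Open Scope ring_scope.

(* The coefficient q_ij of x_i x_j, 1 <= i <= j <= 3, is the field qij.
   Vector entries are indexed from 0: x_1, x_2, x_3 are x 0 0, x 1 0, x 2 0. *)
Record tqform := TQForm {
  q11 : int; q12 : int; q13 : int;
             q22 : int; q23 : int;
                        q33 : int }.

Definition qeval (q : tqform) (x : 'cV[int]_3) : int :=
  q11 q * x 0 0 ^+ 2 + q12 q * x 0 0 * x 1 0 + q13 q * x 0 0 * x 2 0
  + q22 q * x 1 0 ^+ 2 + q23 q * x 1 0 * x 2 0 + q33 q * x 2 0 ^+ 2.

Definition primitive_form (q : tqform) : Prop :=
  \big[gcdz/0]_(c <- [:: q11 q; q12 q; q13 q; q22 q; q23 q; q33 q]) c = 1.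

Definition isotropic (q : tqform) : Prop :=
  exists x : 'cV[int]_3, x != 0 /\ qeval q x = 0.

Definition qmatrix (q : tqform) : 'M[int]_3 :=
  \matrix_(i < 3, j < 3)
    nth 0 (nth [::] [:: [:: 2 * q11 q; q12 q;     q13 q];
                        [:: q12 q;     2 * q22 q; q23 q];
                        [:: q13 q;     q23 q;     2 * q33 q]] i) j.

(* The division is exact, by det_qmatrix below. *)
Definition qdisc (q : tqform) : int := (\det (qmatrix q) %/ 2)%Z.

Lemma det_qmatrix (q : tqform) : \det (qmatrix q) = 2 * qdisc q.
Proof.
suff [d E] : exists d, \det (qmatrix q) = d * 2.
  by rewrite /qdisc E mulzK // mulrC.
exists (4 * q11 q * q22 q * q33 q + q12 q * q13 q * q23 q
        - q11 q * q23 q ^+ 2 - q22 q * q13 q ^+ 2 - q33 q * q12 q ^+ 2).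
rewrite (expand_det_row _ ord0) !big_ord_recl big_ord0 /cofactor.
rewrite !(expand_det_row _ ord0) !big_ord_recl !big_ord0 /cofactor.
by rewrite !det_mx11 !mxE /=; ring.
Qed.

Definition primitive_vec (x : 'cV[int]_3) : Prop :=
  forall d : int, (forall i : 'I_3, (d %| x i 0%R)%Z) -> d <= 1.

Definition in_image (M : 'M[int]_3) (x : 'cV[int]_3) : Prop :=
  exists y : 'cV[int]_3, x = M *m y.

Definition tau (n : nat) : nat := size (divisors n).

(* Square-free is e = 2, cube-free is e = 3. *)
Definition power_free (e n : nat) : Prop :=
  forall d : nat, (d ^ e %| n)%N -> d = 1%N.

(* Main.v *)
Require Import Defs.
From HB Require Import structures.
From mathcomp Require Import all_boot all_order all_algebra.
From mathcomp Require Import ring zify.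

Set Implicit Arguments.
Unset Strict Implicit.
Unset Printing Implicit Defensive.

Import Order.TTheory GRing.Theory Num.Theory.
Local Open Scope ring_scope.

(* Strong induction on the determinant, treating one prime divisor p at a time.
   Modulo p the form degenerates to a binary form, so every primitive zero lies
   in an explicit sublattice of p-power index on which q, divided by a power of
   p, is again primitive and isotropic with a smaller determinant.
   - If the binary form is anisotropic, the lattice is p | x1, p | x2.
   - If it is a multiple of x1^2, the lattice is p | x1.
   - If it is hyperbolic, Hensel lifting makes q congruent to a unit times x1 x2
     modulo p^k, k = v_p(Delta), and the k + 1 lattices p^i | x1, p^(k-i) | x2
     separate the primitive zeros; the new determinant is prime to p.
   The first two cases force p^2 | Delta, so only the third occurs when Delta is
   square-free.  An isotropic form of determinant 1 is equivalent to
   x1 x3 - x2^2.  Along the induction det M | Delta | det(M)^4, which together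
   with Delta det(M)^2 = D^3 gives (v) and (vi).  For (vii), a prime p dividing
   M (s^2, s t, t^2)^T for (s, t) = (1, 0), (0, 1), (1, 1) divides M, hence
   p^3 | det M | Delta; otherwise a good (s, t) is found by the Chinese remainder
   theorem. *)

(** * Explicit 3 by 3 matrices and vectors *)

Definition mat3 (a b c d e f g h i : int) : 'M[int]_3 :=
  \matrix_(r < 3, s < 3)
    nth 0 (nth [::] [:: [:: a; b; c]; [:: d; e; f]; [:: g; h; i]] r) s.

Definition vec3 (a b c : int) : 'cV[int]_3 := \col_(r < 3) nth 0 [:: a; b; c] r.

Lemma ord3P (P : 'I_3 -> Prop) : P 0 -> P 1 -> P 2 -> forall i, P i.
Proof.
move=> P0 P1 P2 [[|[|[|//]]] Hi].
- by congr P: P0; apply/val_inj.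
- by congr P: P1; apply/val_inj.
- by congr P: P2; apply/val_inj.
Qed.

Lemma big_ord3 (F : 'I_3 -> int) : \sum_i F i = F 0 + F 1 + F 2.
Proof.
rewrite !big_ord_recl big_ord0 addr0 addrA.
by congr (_ + F _ + F _); apply/val_inj.
Qed.

Lemma mulmx3E m (M : 'M[int]_3) (x : 'M[int]_(3, m)) i j :
  (M *m x) i j = M i 0 * x 0 j + M i 1 * x 1 j + M i 2 * x 2 j.
Proof. by rewrite mxE big_ord3. Qed.

Lemma mat3_mulE a b c d e f g h i (x : 'cV[int]_3) :
  mat3 a b c d e f g h i *m x
  = vec3 (a * x 0 0 + b * x 1 0 + c * x 2 0)
         (d * x 0 0 + e * x 1 0 + f * x 2 0)
         (g * x 0 0 + h * x 1 0 + i * x 2 0).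
Proof.
apply/matrixP => r s; rewrite (ord1 s) mulmx3E !mxE.
by elim/ord3P: r.
Qed.

Lemma vec3_0 a b c : vec3 a b c 0 0 = a. Proof. by rewrite mxE. Qed.
Lemma vec3_1 a b c : vec3 a b c 1 0 = b. Proof. by rewrite mxE. Qed.
Lemma vec3_2 a b c : vec3 a b c 2 0 = c. Proof. by rewrite mxE. Qed.
Definition vec3E := (vec3_0, vec3_1, vec3_2).

Lemma vec3_eta (x : 'cV[int]_3) : x = vec3 (x 0 0) (x 1 0) (x 2 0).
Proof. by apply/matrixP => r s; rewrite (ord1 s) !mxE; elim/ord3P: r. Qed.

Lemma det_mat3 a b c d e f g h i :
  \det (mat3 a b c d e f g h i)
  = a * (e * i - f * h) - b * (d * i - f * g) + c * (d * h - e * g).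
Proof.
rewrite (expand_det_row _ ord0) !big_ord_recl big_ord0 /cofactor.
rewrite !(expand_det_row _ ord0) !big_ord_recl !big_ord0 /cofactor.
by rewrite !det_mx11 !mxE /=; ring.
Qed.

(** * Determinants of forms under linear substitution *)

Lemma qdiscE q : qdisc q =
  4 * q11 q * q22 q * q33 q + q12 q * q13 q * q23 q
  - q11 q * q23 q ^+ 2 - q22 q * q13 q ^+ 2 - q33 q * q12 q ^+ 2.
Proof.
by apply: (@mulfI _ 2) => //; rewrite -det_qmatrix det_mat3; ring.
Qed.

(** [qmatrix q] is the Gram matrix of the polar form, hence its doubled diagonal; identities between
    values of [q] thus become matrix identities. *)
Lemma qeval_polar q (x y : 'cV[int]_3) :
  (x^T *m qmatrix q *m y) 0 0 = qeval q (x + y) - qeval q x - qeval q y.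
Proof.
rewrite -mulmxA mxE big_ord3 !mulmx3E !mxE /qeval !mxE /=; ring.
Qed.

Lemma qmatrix_subst q q' (L : 'M[int]_3) (e : int) :
  (forall x, qeval q (L *m x) = e * qeval q' x) ->
  L^T *m qmatrix q *m L = e *: qmatrix q'.
Proof.
move=> qL; apply/matrixP => i j.
have entry (A : 'M[int]_3) : A i j = ((delta_mx i 0 : 'cV[int]_3)^T *m A *m (delta_mx j 0 : 'cV[int]_3)) 0 0.
  by rewrite trmx_delta -rowE -colE !mxE.
rewrite entry [RHS]entry -scalemxAr -scalemxAl [RHS]mxE qeval_polar.
rewrite !mulrBr -!qL mulmxDr -qeval_polar trmx_mul !mulmxA.
by [].
Qed.

Lemma qdisc_subst q q' (L : 'M[int]_3) (e : int) :
  (forall x, qeval q (L *m x) = e * qeval q' x) ->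
  qdisc q * \det L ^+ 2 = e ^+ 3 * qdisc q'.
Proof.
move=> /qmatrix_subst /(congr1 determinant).
rewrite !det_mulmx det_tr detZ !det_qmatrix => E.
apply: (@mulfI _ 2) => //.
have -> : 2 * (qdisc q * \det L ^+ 2) = \det L * (2 * qdisc q) * \det L by ring.
by rewrite E mulrCA.
Qed.

(** * Primitivity and isotropy under substitution *)

(** Stated through values rather than coefficients, primitivity passes along a substitution without
    computing the coefficients of the new form. *)
Definition primitive_at_primes (q : tqform) : Prop :=
  forall p : nat, prime p -> ~ (forall x, (p%:Z %| qeval q x)%Z).

Lemma dvdz_prime_mul (p : nat) (m n : int) : prime p ->
  (p%:Z %| m * n)%Z = (p%:Z %| m)%Z || (p%:Z %| n)%Z.
Proof. by move=> pp; rewrite !dvdzE abszM Euclid_dvdM. Qed.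

Lemma dvdz_prime_exp (p : nat) (m : int) n : prime p ->
  (p%:Z %| m ^+ n)%Z -> (p%:Z %| m)%Z.
Proof. by move=> pp; rewrite !dvdzE abszX Euclid_dvdX // => /andP[]. Qed.

Lemma coprimez_pfactor (p : nat) k (m : int) : prime p ->
  ~~ (p%:Z %| m)%Z -> coprimez (p%:Z ^+ k) m.
Proof.
move=> pp pm; rewrite coprimezE abszX coprimeXl //.
by rewrite prime_coprime // -dvdzE.
Qed.

Lemma inverse_mod (p : nat) (m : int) : prime p -> ~~ (p%:Z %| m)%Z ->
  exists b c : int, m * b = 1 + c * p%:Z.
Proof.
move=> pp /(coprimez_pfactor 1 pp); rewrite expr1 => /eqP cop.
have [u [v uv]] := Bezoutz p%:Z m.
exists v, (- u); rewrite cop in uv; rewrite -uv; ring.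
Qed.

(** Each coefficient is a value at a basis vector, or the polarization of [q] at two of them. *)
Lemma dvdz_coefs (d : int) q :
  (forall x, (d %| qeval q x)%Z) <->
  [/\ (d %| q11 q)%Z, (d %| q12 q)%Z & (d %| q13 q)%Z] /\
  [/\ (d %| q22 q)%Z, (d %| q23 q)%Z & (d %| q33 q)%Z].
Proof.
split=> [dq | [[d11 d12 d13] [d22 d23 d33]] x]; last first.
  by rewrite /qeval !rpredD // -?mulrA dvdz_mulr.
have d1 := dq (vec3 1 0 0); have d2 := dq (vec3 0 1 0).
have d3 := dq (vec3 0 0 1); have d12 := dq (vec3 1 1 0).
have d13 := dq (vec3 1 0 1); have d23 := dq (vec3 0 1 1).
have e1 : qeval q (vec3 1 0 0) = q11 q by rewrite /qeval !vec3E; ring.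
have e2 : qeval q (vec3 0 1 0) = q22 q by rewrite /qeval !vec3E; ring.
have e3 : qeval q (vec3 0 0 1) = q33 q by rewrite /qeval !vec3E; ring.
have e12 : q12 q = qeval q (vec3 1 1 0) - q11 q - q22 q.
  by rewrite /qeval !vec3E; ring.
have e13 : q13 q = qeval q (vec3 1 0 1) - q11 q - q33 q.
  by rewrite /qeval !vec3E; ring.
have e23 : q23 q = qeval q (vec3 0 1 1) - q22 q - q33 q.
  by rewrite /qeval !vec3E; ring.
by rewrite e12 e13 e23 -e1 -e2 -e3 !rpredB.
Qed.

Lemma primitive_form_at_primes q : primitive_form q -> primitive_at_primes q.
Proof.
rewrite /primitive_form !big_cons big_nil => q1 p pp.
move=> /dvdz_coefs [[d11 d12 d13] [d22 d23 d33]].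
have : (p%:Z %| 1%R)%Z by rewrite -q1 !dvdz_gcd d11 d12 d13 d22 d23 d33 dvdz0.
by rewrite dvdzE /= Euclid_dvd1.
Qed.

Lemma qevalZ q a x : qeval q (a *: x) = a ^+ 2 * qeval q x.
Proof. by rewrite /qeval !mxE; ring. Qed.

Lemma qeval_adj q q' (L : 'M[int]_3) (e : int) :
  (forall x, qeval q (L *m x) = e * qeval q' x) ->
  forall x, e * qeval q' (\adj L *m x) = \det L ^+ 2 * qeval q x.
Proof.
by move=> qL x; rewrite -qL mulmxA mul_mx_adj mul_scalar_mx qevalZ.
Qed.

Lemma mulmx_det_inj (L : 'M[int]_3) (x y : 'cV[int]_3) :
  \det L != 0 -> L *m x = L *m y -> x = y.
Proof.
move=> L0 /(congr1 (mulmx (\adj L))); rewrite !mulmxA !mul_adj_mx !mul_scalar_mx.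
by move=> /matrixP E; apply/matrixP => i j; move: (E i j); rewrite !mxE; apply: mulfI.
Qed.

Lemma isotropic_subst q q' (L : 'M[int]_3) (e : int) :
  \det L != 0 -> e != 0 ->
  (forall x, qeval q (L *m x) = e * qeval q' x) -> isotropic q -> isotropic q'.
Proof.
move=> L0 e0 qL [x [x0 qx]]; exists (\adj L *m x); split.
  apply: contra x0 => /eqP /(congr1 (mulmx L)).
  rewrite mulmxA mul_mx_adj mul_scalar_mx mulmx0 => /matrixP E.
  apply/eqP/matrixP => i j; move: (E i j); rewrite !mxE => /eqP.
  by rewrite mulf_eq0 (negPf L0) => /eqP.
by apply: (mulfI e0); rewrite (qeval_adj qL) qx !mulr0.
Qed.

(** A prime [l] other than [p] dividing all values of [q'] divides [\det L ^+ 2 * qeval q x] by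
    [qeval_adj], hence [qeval q x], since [\det L] is a power of [p]. *)
Lemma primitive_subst q q' (L : 'M[int]_3) (e : int) (p m : nat) :
  prime p -> \det L = p%:Z ^+ m ->
  (forall x, qeval q (L *m x) = e * qeval q' x) ->
  primitive_at_primes q -> ~ (forall x, (p%:Z %| qeval q' x)%Z) ->
  primitive_at_primes q'.
Proof.
move=> pp detL qL prim primp l lp dl; have [lep | nlp] := eqVneq l p.
  by apply: primp; rewrite -lep.
apply: (prim l lp) => x.
have : (l%:Z %| \det L ^+ 2 * qeval q x)%Z.
  by rewrite -(qeval_adj qL) dvdz_mull.
rewrite detL -exprM dvdz_prime_mul // => /orP[/(dvdz_prime_exp lp)|//].
by rewrite dvdzE /= dvdn_prime2 // (negPf nlp).
Qed.

(** * Counting divisors *)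

Lemma tau_le m n : (0 < n)%N -> (m %| n)%N -> (tau m <= tau n)%N.
Proof.
move=> n0 mn; have m0 := dvdn_gt0 n0 mn.
apply: uniq_leq_size; first exact: divisors_uniq.
by move=> d; rewrite -!dvdn_divisors // => /dvdn_trans; apply.
Qed.

(** The divisors of [p ^ k * m] are the products [p ^ i * d] with [i <= k] and [d %| m], and the
    [p]-adic valuation recovers [i]. *)
Lemma tau_pfactor_mul p k m : prime p -> (0 < m)%N -> coprime p m ->
  tau (p ^ k * m) = (k.+1 * tau m)%N.
Proof.
move=> pp m0 cop; have pk0 i : (0 < p ^ i)%N by rewrite expn_gt0 prime_gt0.
have size_pairs : (k.+1 * tau m)%N =
    size [seq (p ^ i * d)%N | i <- iota 0 k.+1, d <- divisors m].
  by rewrite size_allpairs size_iota.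
rewrite size_pairs; apply/perm_size/uniq_perm; first exact: divisors_uniq.
  apply: allpairs_uniq; [exact: iota_uniq | exact: divisors_uniq |].
  move=> _ _ /allpairsP[[i d] [_ dm ->]] /allpairsP[[j d'] [_ dm' ->]] /= E.
  move: dm dm'; rewrite -!dvdn_divisors // => dm dm'.
  have lgd e : (e %| m)%N -> logn p e = 0%N.
    move=> em; rewrite lognE pp (dvdn_gt0 m0 em) /=; case: ifP => // pe.
    by move: cop; rewrite prime_coprime // (dvdn_trans pe em).
  have lgM i' e : (e %| m)%N -> logn p (p ^ i' * e) = i'.
    by move=> em; rewrite lognM ?(dvdn_gt0 m0 em) // pfactorK // lgd ?addn0.
  have Eij : i = j by rewrite -(lgM i d) // -(lgM j d') // E.
  by move/eqP: E; rewrite Eij eqn_pmul2l // => /eqP ->.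
move=> e; rewrite -dvdn_divisors ?muln_gt0 ?pk0 //.
apply/idP/allpairsP => [epm | [[i d] [ik dm ->]]]; last first.
  move: ik dm; rewrite mem_iota /= -dvdn_divisors // => ik dm.
  by rewrite dvdn_mul // dvdn_exp2l.
(* A divisor [e] is the product of its gcds with the coprime factors [p ^ k] and [m]. *)
have [i ik ei] : exists2 i, (i <= k)%N & gcdn e (p ^ k) = (p ^ i)%N.
  by have /(dvdn_pfactor _ _ pp) [i] := dvdn_gcdr e (p ^ k); exists i.
exists (i, gcdn e m); rewrite mem_iota /= ltnS ik -dvdn_divisors // dvdn_gcdr.
split=> //; apply/eqP; rewrite -ei eqn_dvd; apply/andP; split.
  by rewrite muln_gcdr !muln_gcdl !dvdn_gcd epm dvdn_mulr // dvdn_mull // dvdn_mulr.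
rewrite Gauss_dvd ?dvdn_gcdl //.
apply: (coprime_dvdl (dvdn_gcdr _ _)); apply: (coprime_dvdr (dvdn_gcdr _ _)).
exact: coprimeXl.
Qed.

Lemma power_free_dvd e m n : (m %| n)%N -> power_free e n -> power_free e m.
Proof. by move=> mn pf d dm; apply: pf; apply: dvdn_trans mn. Qed.

(** * Parametrizations and their composition along sublattices *)

(* The four clauses are enough to recover all of the numerical relations of
   the theorem, the identity for [D] giving [qdisc q * \det M ^+ 2 = D ^+ 3]. *)
Definition parametrized_by (q : tqform) (T : finType)
    (M : T -> 'M[int]_3) (D : T -> int) : Prop :=
  [/\ (#|T| <= tau `|qdisc q|)%N
      /\ (power_free 2 `|qdisc q| -> #|T| = tau `|qdisc q|),
    forall k, (\det (M k) %| qdisc q)%Z /\ (qdisc q %| \det (M k) ^+ 4)%Z,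
    forall k x, qeval q (M k *m x) = D k * (x 0 0 * x 2 0 - x 1 0 ^+ 2)
  & forall x, primitive_vec x -> qeval q x = 0 ->
      exists! k, in_image (M k) x].

Definition parametrizable (q : tqform) : Prop :=
  exists (K : nat) (M : 'I_K -> 'M[int]_3) (D : 'I_K -> int),
    parametrized_by q M D.

(** Composing parametrizations indexes them by dependent pairs; enumerating the finite type brings
    the index back to an ordinal. *)
Lemma parametrizable_fin q (T : finType) (M : T -> 'M[int]_3) (D : T -> int) :
  parametrized_by q M D -> parametrizable q.
Proof.
move=> [Kle Mdvd MD cover].
exists #|T|, (fun k => M (enum_val k)), (fun k => D (enum_val k)).
split=> [|k|k|x px qx]; rewrite ?card_ord //.
have [k [xk uk]] := cover x px qx; exists (enum_rank k).
split=> [|k' xk']; first by rewrite enum_rankK.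
by rewrite (uk _ xk') enum_valK.
Qed.

Lemma primitive_vec_mulmx (L : 'M[int]_3) (y : 'cV[int]_3) :
  primitive_vec (L *m y) -> primitive_vec y.
Proof.
move=> prim d dy; apply: prim => i.
by rewrite mxE rpred_sum // => j _; rewrite dvdz_mull.
Qed.

(** Each [L j] is composed with the matrices that parametrize [q' j]. The factor [c j] lost by the
    determinant obeys the same two divisibilities as [qdisc q] in [parametrized_by], so both
    multiply along the composition. *)
Lemma parametrizable_refine q (J : finType) (L : J -> 'M[int]_3)
    (e c : J -> int) (q' : J -> tqform) :
  qdisc q != 0 ->
  (forall j, \det (L j) != 0 /\ e j != 0) ->
  (forall j x, qeval q (L j *m x) = e j * qeval (q' j) x) ->
  (forall j, [/\ qdisc q = c j * qdisc (q' j),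
                 (\det (L j) %| c j)%Z & (c j %| \det (L j) ^+ 4)%Z]) ->
  (forall x, primitive_vec x -> qeval q x = 0 ->
     exists! j, in_image (L j) x) ->
  (\sum_j tau `|qdisc (q' j)| <= tau `|qdisc q|)%N ->
  (power_free 2 `|qdisc q| ->
     (\sum_j tau `|qdisc (q' j)|)%N = tau `|qdisc q|) ->
  (forall j, parametrizable (q' j)) -> parametrizable q.
Proof.
move=> q0 Le0 qL dL coverL tau_le_sum tau_sum par.
(* Packing size, matrices and multipliers into one value lets [fin_all_exists] choose them for all
   [j] at once. *)
have par' j : exists u : {K : nat & (('I_K -> 'M[int]_3) * ('I_K -> int))%type},
    parametrized_by (q' j) (tagged u).1 (tagged u).2.
  by have [K [M [D]]] := par j; exists (existT _ K (M, D)).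
have [u uP] := fin_all_exists par'.
pose K j := tag (u j).
pose T : finType := {j : J & 'I_(K j)}.
pose M (t : T) := L (tag t) *m (tagged (u (tag t))).1 (tagged t).
pose D (t : T) := e (tag t) * (tagged (u (tag t))).2 (tagged t).
have cardT : #|T| = (\sum_j K j)%N.
  rewrite card_tagged sumnE big_map big_enum /=.
  by apply: eq_bigr => j _; rewrite card_ord.
apply: (@parametrizable_fin q T M D); split.
- rewrite cardT; split=> [|pf].
    apply: leq_trans tau_le_sum; apply: leq_sum => j _.
    by case: (uP j) => [[Kle _] _ _ _]; rewrite card_ord in Kle.
  rewrite -tau_sum //; apply: eq_bigr => j _.
  case: (uP j) => [[_ Keq] _ _ _]; rewrite card_ord in Keq; apply: Keq.
  by apply: power_free_dvd pf; have [-> _ _] := dL j; rewrite abszM dvdn_mull.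
- case=> j k; case: (uP j) => [_ /(_ k) [d1 d2] _ _].
  have [-> d3 d4] := dL j; rewrite det_mulmx exprMn.
  by rewrite !dvdz_mul.
- case=> j k x; case: (uP j) => [_ _ E _].
  by rewrite /M /D /= -mulmxA qL E mulrA.
move=> x px qx; have [j [[y xy] uj]] := coverL x px qx.
case: (uP j) => [_ _ _ cover].
have [||k [[z yz] uk]] := cover y.
- by rewrite xy in px; apply: primitive_vec_mulmx px.
- by apply: (mulfI (proj2 (Le0 j))); rewrite -qL -xy qx mulr0.
exists (existT _ j k); split=> [|[j' k'] [z']]; first by exists z; rewrite -mulmxA -yz.
rewrite /M /= -mulmxA => xz'.
(* A point of the composite image lies in the image of [L j'], which fixes the first index;
   injectivity of [L j] then fixes the preimage, hence the second. *)
have Ej : j = j' by apply: uj; exists ((tagged (u j')).1 k' *m z').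
case: j' / Ej k' xz' => k' xz'; congr existT; apply: uk; exists z'.
by apply: (mulmx_det_inj (proj1 (Le0 j))); rewrite -xy.
Qed.

(** * Admissible forms and unimodular equivalence *)

Definition admissible (q : tqform) : Prop :=
  [/\ primitive_at_primes q, isotropic q & 0 < qdisc q].

Lemma admissible_subst q q' (L : 'M[int]_3) (e : int) (p m : nat) :
  prime p -> \det L = p%:Z ^+ m -> 0 < e ->
  (forall x, qeval q (L *m x) = e * qeval q' x) ->
  ~ (forall x, (p%:Z %| qeval q' x)%Z) -> admissible q -> admissible q'.
Proof.
move=> pp detL e0 qL primp [prim iso disc0].
have detL0 : \det L != 0 by rewrite detL expf_neq0 //; have := prime_gt0 pp; lia.
split.
- exact: primitive_subst pp detL qL prim primp.
- by apply: isotropic_subst detL0 _ qL iso; rewrite gt_eqF.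
- have := qdisc_subst qL; have : 0 < qdisc q * \det L ^+ 2.
    by rewrite mulr_gt0 // exprn_even_gt0.
  by move=> + E; rewrite E pmulr_rgt0 // exprn_gt0.
Qed.

Definition equivalent (q q' : tqform) : Prop :=
  exists2 U : 'M[int]_3, \det U = 1 & forall x, qeval q (U *m x) = qeval q' x.

Lemma equivalent_trans q1 q2 q3 :
  equivalent q1 q2 -> equivalent q2 q3 -> equivalent q1 q3.
Proof.
move=> [U U1 E12] [V V1 E23]; exists (U *m V).
  by rewrite det_mulmx U1 V1.
by move=> x; rewrite -mulmxA E12.
Qed.

Lemma equivalent_qdisc q q' : equivalent q q' -> qdisc q = qdisc q'.
Proof.
move=> [U U1 E]; have := @qdisc_subst q q' U 1.
by rewrite U1 !expr1n mulr1 mul1r; apply => x; rewrite mul1r.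
Qed.

Lemma equivalent_admissible q q' :
  equivalent q q' -> admissible q -> admissible q'.
Proof.
move=> eqv [prim iso disc0]; split; last by rewrite -(equivalent_qdisc eqv).
- case: eqv => U U1 E l lp dl; apply: (prim l lp) => x.
  have -> : x = U *m (\adj U *m x).
    by rewrite mulmxA mul_mx_adj U1 mul1mx.
  by rewrite E.
- case: eqv => U U1 E; apply: (@isotropic_subst q q' U 1) iso => //.
    by rewrite U1.
  by move=> x; rewrite mul1r.
Qed.

Lemma exists_unique_unit (T : Prop) : T -> exists! j : unit, T.
Proof. by move=> t; exists tt; split=> // -[]. Qed.

Lemma equivalent_parametrizable q q' : qdisc q != 0 ->
  equivalent q q' -> parametrizable q' -> parametrizable q.
Proof.
move=> q0 eqv par; have Ed := equivalent_qdisc eqv; case: eqv => U U1 E.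
apply: (@parametrizable_refine q unit (fun=> U) (fun=> 1) (fun=> 1) (fun=> q')).
- by [].
- by rewrite U1.
- by move=> j x; rewrite mul1r.
- by move=> j; rewrite U1 mul1r.
- move=> x _ _; apply: exists_unique_unit; exists (\adj U *m x).
  by rewrite mulmxA mul_mx_adj U1 mul1mx.
- by rewrite sum_nat_const card_unit mul1n Ed.
- by rewrite sum_nat_const card_unit mul1n Ed.
- by [].
Qed.

Lemma equivalent_shear q (k l : int) : equivalent q
  (TQForm (q11 q) (q12 q + 2 * k * q11 q) (q13 q + 2 * l * q11 q)
          (q22 q + k * q12 q + k ^+ 2 * q11 q)
          (q23 q + k * q13 q + l * q12 q + 2 * k * l * q11 q)
          (q33 q + l * q13 q + l ^+ 2 * q11 q)).
Proof.
exists (mat3 1 k l 0 1 0 0 0 1); first by rewrite det_mat3; ring.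
by move=> x; rewrite mat3_mulE /qeval !vec3E /=; ring.
Qed.

Lemma equivalent_swap q : equivalent q
  (TQForm (q22 q) (- q12 q) (- q23 q) (q11 q) (q13 q) (q33 q)).
Proof.
exists (mat3 0 1 0 (-1) 0 0 0 0 1); first by rewrite det_mat3; ring.
by move=> x; rewrite mat3_mulE /qeval !vec3E /=; ring.
Qed.

Lemma equivalent_rot q : equivalent q
  (TQForm (q22 q) (q23 q) (q12 q) (q33 q) (q13 q) (q11 q)).
Proof.
exists (mat3 0 0 1 1 0 0 0 1 0); first by rewrite det_mat3; ring.
by move=> x; rewrite mat3_mulE /qeval !vec3E /=; ring.
Qed.

(** Off-diagonal coefficients are read off the matrix [B], diagonal ones are taken as values of [q],
    which avoids halving. *)
Lemma equivalent_det1 q (U : 'M[int]_3) : \det U = 1 ->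
  exists2 q', q11 q' = qeval q (U *m vec3 1 0 0) & equivalent q q'.
Proof.
move=> U1; pose B := U^T *m qmatrix q *m U.
exists (TQForm (qeval q (U *m vec3 1 0 0)) (B 0 1) (B 0 2)
          (qeval q (U *m vec3 0 1 0)) (B 1 2) (qeval q (U *m vec3 0 0 1))) => //.
exists U => // y; rewrite /B /qeval /= -!mulmxA !mulmx3E !vec3E !mxE /=.
ring.
Qed.

(** * Normal form of an isotropic form, and determinant 1 *)

(** These are the quotients by the gcd, except for [y = z = 0], where the pair [1, 0] keeps the
    cofactors coprime. *)
Lemma gcd_cofactors (y z : int) : exists g y' z' u v : int,
  [/\ y = g * y', z = g * z' & u * y' + v * z' = 1].
Proof.
have [u [v uv]] := Bezoutz y z; set g := gcdz y z in uv.
have [/eqP g0 | g0] := boolP (g == 0).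
  move/eqP: g0; rewrite gcdz_eq0 => /andP[/eqP-> /eqP->].
  by exists 0, 1, 0, 1, 0; rewrite !mul0r addr0 mulr1.
have /dvdzP [y' Ey] := dvdz_gcdl y z; have /dvdzP [z' Ez] := dvdz_gcdr y z.
exists g, y', z', u, v; split; [by rewrite mulrC | by rewrite mulrC |].
apply: (mulfI g0); rewrite mulr1; transitivity (u * (y' * g) + v * (z' * g)).
  by ring.
by rewrite -Ey -Ez uv.
Qed.

(* Move a zero to a multiple of the first basis vector by two Bezout steps, then
   rotate the last two coordinates to clear the coefficient [q13]. *)
Lemma isotropic_normal_form q : isotropic q ->
  exists a b c d : int, equivalent q (TQForm 0 a 0 b c d).
Proof.
move=> [x [x0 qx]].
have [g [y' [z' [u [v [Ey Ez uv]]]]]] := gcd_cofactors (x 1 0) (x 2 0).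
have [h [s' [t' [u1 [v1 [Es Et uv1]]]]]] := gcd_cofactors (x 0 0) g.
pose U := mat3 1 0 0 0 y' (- v) 0 z' u *m mat3 s' (- v1) 0 t' u1 0 0 0 1.
have detU : \det U = 1.
  rewrite det_mulmx !det_mat3; transitivity ((u * y' + v * z') * (u1 * s' + v1 * t')).
    by ring.
  by rewrite uv uv1 mulr1.
have xU : x = U *m vec3 h 0 0.
  rewrite /U -mulmxA !mat3_mulE !vec3E [LHS]vec3_eta Es Ey Ez Et.
  by congr vec3; ring.
have h0 : h != 0.
  apply: contra x0 => /eqP h0; rewrite xU h0; apply/eqP.
  have -> : vec3 0 0 0 = 0 by apply/matrixP => i j; rewrite !mxE; elim/ord3P: i.
  by rewrite mulmx0.
have [q1 q11E eqv1] := equivalent_det1 q detU.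
have q110 : q11 q1 = 0.
  have : qeval q (U *m vec3 h 0 0) = h ^+ 2 * q11 q1.
    rewrite q11E -qevalZ scalemxAr; congr (qeval _ (_ *m _)).
    by apply/matrixP => i j; rewrite !mxE; elim/ord3P: i; rewrite /= ?mulr0 ?mulr1.
  by rewrite -xU qx => /esym/eqP; rewrite mulf_eq0 expf_eq0 (negPf h0) => /eqP.
have [w [y1 [z1 [u2 [v2 [E2 E3 uv2]]]]]] := gcd_cofactors (q12 q1) (q13 q1).
exists w, (u2 ^+ 2 * q22 q1 + u2 * v2 * q23 q1 + v2 ^+ 2 * q33 q1),
  (- (2 * u2 * z1 * q22 q1) + (u2 * y1 - z1 * v2) * q23 q1 + 2 * v2 * y1 * q33 q1),
  (z1 ^+ 2 * q22 q1 - z1 * y1 * q23 q1 + y1 ^+ 2 * q33 q1).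
apply: equivalent_trans eqv1 _.
exists (mat3 1 0 0 0 u2 (- z1) 0 v2 y1).
  by rewrite det_mat3 -[RHS]uv2; ring.
move=> y; rewrite mat3_mulE /qeval !vec3E /= q110 E2 E3.
transitivity ((u2 * y1 + v2 * z1) * w * y 0 0 * y 1 0 +
 q22 q1 * (u2 * y 1 0 - z1 * y 2 0) ^+ 2 + q23 q1 * (u2 * y 1 0 - z1 * y 2 0) * (v2 * y 1 0 + y1 * y 2 0)
 + q33 q1 * (v2 * y 1 0 + y1 * y 2 0) ^+ 2); first by ring.
by rewrite uv2; ring.
Qed.

(** The normal form has determinant [- d * a ^+ 2], so [a ^+ 2 = 1] and [d = -1], and the form is
    [x2 (a x1 + b x2 + c x3) - x3^2]. *)
Lemma parametrizable_disc1 q : isotropic q -> qdisc q = 1 -> parametrizable q.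
Proof.
move=> /isotropic_normal_form [a [b [c [d eqv]]]] q1.
have q0 : qdisc q != 0 by rewrite q1.
apply: (equivalent_parametrizable q0 eqv).
move: q1; rewrite (equivalent_qdisc eqv); set q' := TQForm _ _ _ _ _ _ => q1.
have da : - d * a ^+ 2 = 1 by rewrite -[RHS]q1 qdiscE /=; ring.
have a1 : a ^+ 2 = 1.
  have /eqP := congr1 absz da; rewrite expr2 !abszM !muln_eq1.
  by move=> /and3P[_ /eqP absa _]; have [-> | ->] : a = 1 \/ a = -1 by lia.
have d1 : d = -1 by rewrite -da a1; ring.
(* [M] solves [a x1 + b x2 + c x3 = y1], [x3 = a y2], [x2 = y3], using [a ^+ 2 = 1]. *)
pose M := mat3 a (- a ^+ 2 * c) (- a * b) 0 0 1 0 a 0.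
have M1 : \det M = -1 by rewrite det_mat3 -[in RHS]a1; ring.
apply: (@parametrizable_fin q' unit (fun=> M) (fun=> 1)); split.
- by rewrite card_unit q1.
- by move=> _; rewrite M1 q1.
- move=> _ x; rewrite mat3_mulE /qeval !vec3E /= d1.
  transitivity (a ^+ 2 * (x 0 0 * x 2 0 - x 1 0 ^+ 2) + (1 - a ^+ 2) *
    (b * x 2 0 ^+ 2 + a * c * x 1 0 * x 2 0)); first by ring.
  by rewrite a1; ring.
(* [- \adj M] is the inverse of [M], whose determinant is -1. *)
- move=> x _ _; apply: exists_unique_unit; exists (- \adj M *m x).
  rewrite mulmxA mulmxN mul_mx_adj M1 -scalemx1 -scaleN1r scalerA.
  by rewrite mulrNN mulr1 scale1r mul1mx.
Qed.

(** * Diagonal sublattices and descent to a single one *)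

Lemma in_image_diag3 (a b c : int) (x : 'cV[int]_3) :
  in_image (mat3 a 0 0 0 b 0 0 0 c) x <->
  [/\ (a %| x 0%R 0%R)%Z, (b %| x 1%R 0%R)%Z & (c %| x 2%R 0%R)%Z].
Proof.
split=> [[y ->] | [/dvdzP[u Eu] /dvdzP[v Ev] /dvdzP[w Ew]]].
  by rewrite mat3_mulE !vec3E !mul0r !add0r !addr0 !dvdz_mulr.
exists (vec3 u v w); rewrite mat3_mulE !vec3E [LHS]vec3_eta Eu Ev Ew.
by congr vec3; ring.
Qed.

Lemma det_diag3 (a b c : int) : \det (mat3 a 0 0 0 b 0 0 0 c) = a * b * c.
Proof. by rewrite det_mat3; ring. Qed.

Lemma qeval_diag3 q (a b c : int) x : qeval q (mat3 a 0 0 0 b 0 0 0 c *m x) =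
  qeval (TQForm (a ^+ 2 * q11 q) (a * b * q12 q) (a * c * q13 q)
                (b ^+ 2 * q22 q) (b * c * q23 q) (c ^+ 2 * q33 q)) x.
Proof. by rewrite mat3_mulE /qeval !vec3E /=; ring. Qed.

Lemma primitive_vec_prime p (x : 'cV[int]_3) : prime p -> primitive_vec x ->
  ~ [/\ (p%:Z %| x 0%R 0%R)%Z, (p%:Z %| x 1%R 0%R)%Z & (p%:Z %| x 2%R 0%R)%Z].
Proof.
move=> pp prim [p0 p1 p2]; have /prim : forall i, (p%:Z %| x i 0%R)%Z.
  by elim/ord3P.
by have := prime_gt1 pp; lia.
Qed.

Lemma parametrizable_descent q q' (L : 'M[int]_3) (e c : int) (p m : nat) :
  prime p -> admissible q ->
  \det L = p%:Z ^+ m -> 0 < e ->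
  (forall x, qeval q (L *m x) = e * qeval q' x) ->
  ~ (forall x, (p%:Z %| qeval q' x)%Z) ->
  c * \det L ^+ 2 = e ^+ 3 -> (\det L %| c)%Z -> (c %| \det L ^+ 4)%Z -> 1 < c ->
  (p%:Z ^+ 2 %| qdisc q)%Z ->
  (forall x, primitive_vec x -> qeval q x = 0 -> in_image L x) ->
  (forall r, admissible r -> (`|qdisc r| < `|qdisc q|)%N -> parametrizable r) ->
  parametrizable q.
Proof.
move=> pp adm detL e0 qL primp cE dLc dcL c1 p2 cover IH.
have [_ _ disc0] := adm.
have adm' := admissible_subst pp detL e0 qL primp adm.
have [_ _ disc'0] := adm'.
have detL0 : \det L != 0 by rewrite detL expf_neq0 //; have := prime_gt0 pp; lia.
have Ed : qdisc q = c * qdisc q'.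
  apply: (mulIf (expf_neq0 2 detL0)).
  by rewrite (qdisc_subst qL) -cE mulrAC.
have lt : (`|qdisc q'| < `|qdisc q|)%N by rewrite Ed; nia.
apply: (@parametrizable_refine q unit (fun=> L) (fun=> e) (fun=> c) (fun=> q')).
- by rewrite gt_eqF.
- by split=> //; rewrite gt_eqF.
- by [].
- by [].
- by move=> x px qx; apply: exists_unique_unit; apply: cover.
- rewrite sum_nat_const card_unit mul1n Ed abszM.
  by apply: tau_le; rewrite ?dvdn_mull // muln_gt0; apply/andP; split; lia.
(* The equality clause is vacuous: [p ^ 2] divides the determinant, so it is not square-free. *)
- move=> /(_ p); rewrite dvdzE abszX in p2 => /(_ p2) p1.
  by move: pp; rewrite p1.
- by move=> _; apply: IH.
Qed.

(** * The hyperbolic case *)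

(* [q12 * x1 * x2] plus multiples of [A] and [B]; no condition is put on [q33],
   which the discriminant controls. *)
Definition hyperbolic_mod (p : nat) (A B : int) (q : tqform) : Prop :=
  [/\ ~~ (p%:Z %| q12 q)%Z, (A %| q11 q)%Z, (A %| q13 q)%Z,
      (B %| q22 q)%Z & (B %| q23 q)%Z].

(** A Hensel step: with [u] inverse to [q12] modulo [p], replace [x1] by [x1 - u (q22 x2 + q23 x3)].
    This multiplies [q22] by [1 - q12 u + u^2 q22 q11], a multiple of [p] because [p] divides [A]
    and so [q11]; [q23] behaves alike, up to the term [u q22 q13], a multiple of [B p]. *)
Lemma hyperbolic_shear p A B q : prime p -> (p%:Z %| A)%Z ->
  hyperbolic_mod p A B q ->
  exists2 q', equivalent q q' & hyperbolic_mod p A (B * p%:Z) q'.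
Proof.
move=> pp pA [p12 A11 A13 B22 B23].
have [u [v uv]] := inverse_mod pp p12.
have /dvdzP [a Ea] := dvdz_trans pA A11; have /dvdzP [b Eb] := dvdz_trans pA A13.
refine (ex_intro2 _ _ _ (equivalent_shear q (- u * q22 q) (- u * q23 q)) _).
move: B22 B23 => /dvdzP [c Ec] /dvdzP [d Ed].
split=> /=.
- apply: contra p12 => p12.
  have -> : q12 q = q12 q + 2 * (- u * q22 q) * q11 q + 2 * u * q22 q * q11 q by ring.
  by rewrite rpredD // Ea mulrA dvdz_mull.
- by [].
- by rewrite rpredD // dvdz_mull.
- have -> : q22 q + - u * q22 q * q12 q + (- u * q22 q) ^+ 2 * q11 q
    = q22 q * (1 - q12 q * u + u ^+ 2 * q22 q * q11 q) by ring.
  rewrite uv Ea {1}Ec -mulrA (mulrCA c) dvdz_mul // ?dvdz_mull //.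
  by apply/dvdzP; exists (- v + u ^+ 2 * q22 q * a); ring.
- have -> : q23 q + - u * q22 q * q13 q + - u * q23 q * q12 q
      + 2 * (- u * q22 q) * (- u * q23 q) * q11 q
    = q23 q * (1 - q12 q * u + 2 * u ^+ 2 * q22 q * q11 q) - u * q22 q * q13 q by ring.
  rewrite uv Ea Eb Ec Ed; apply/dvdzP.
  by exists (d * (- v + 2 * u ^+ 2 * (c * B) * a) - u * c * b); ring.
Qed.

Lemma hyperbolic_swap p A B q : hyperbolic_mod p A B q ->
  exists2 q', equivalent q q' & hyperbolic_mod p B A q'.
Proof.
move=> [p12 A11 A13 B22 B23]; refine (ex_intro2 _ _ _ (equivalent_swap q) _).
by split; rewrite /= ?rpredN.
Qed.

Lemma hyperbolic_lift p q k : prime p -> hyperbolic_mod p p%:Z 1 q ->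
  exists2 q', equivalent q q' & hyperbolic_mod p (p%:Z ^+ k.+1) (p%:Z ^+ k.+1) q'.
Proof.
move=> pp hq; elim: k => [|k [q1 eqv1 h1]].
  by rewrite expr1; have := hyperbolic_shear pp (dvdzz _) hq; rewrite mul1r.
have pdvd m : (p%:Z %| p%:Z ^+ m.+1)%Z by rewrite exprS dvdz_mulr.
(* A shear raises the second exponent; the swap lets another shear raise the first. *)
have [q2 eqv2 h2] := hyperbolic_shear pp (pdvd k) h1.
rewrite -exprSr in h2; have [q3 eqv3 h3] := hyperbolic_swap h2.
have [q4 eqv4 h4] := hyperbolic_shear pp (pdvd _) h3; exists q4.
  exact: equivalent_trans (equivalent_trans eqv1 eqv2) (equivalent_trans eqv3 eqv4).
by rewrite -exprSr in h4.
Qed.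

Lemma dvdz_pfactor_mul p k (a b : int) : prime p -> (p%:Z ^+ k %| a * b)%Z ->
  exists2 i, (i <= k)%N & (p%:Z ^+ i %| a)%Z /\ (p%:Z ^+ (k - i) %| b)%Z.
Proof.
move=> pp; elim: k a => [|k IH] a; first by exists 0%N; rewrite // !expr0 !dvd1z.
have [/dvdzP [a' ->] | pa] := boolP (p%:Z %| a)%Z; last first.
  rewrite Gauss_dvdzr ?coprimez_pfactor // => pb.
  by exists 0%N; rewrite // expr0 dvd1z subn0.
have p0 : p%:Z != 0 by have := prime_gt0 pp; lia.
rewrite mulrAC exprSr dvdz_mul2r // => /IH [i ik [ia ib]].
by exists i.+1; rewrite // subSS exprSr dvdz_mul2r.
Qed.

(** On each of the [k + 1] lattices, of determinant [P = p ^ k], the form is [P] times [q' i], so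
    its determinant drops by [P ^ 3 / P ^ 2 = P] to the part [m] prime to [p]. The counts add up to
    [(k + 1) tau(m)], which is the divisor count of [p ^ k * m]. *)
Lemma parametrizable_hyperbolic_pow p q (k := logn p `|qdisc q|) :
  prime p -> admissible q -> (0 < k)%N ->
  hyperbolic_mod p (p%:Z ^+ k) (p%:Z ^+ k) q ->
  (forall r, admissible r -> (`|qdisc r| < `|qdisc q|)%N -> parametrizable r) ->
  parametrizable q.
Proof.
move=> pp adm k0 [p12 d11 d13 d22 d23] IH; have [_ _ disc0] := adm.
have [P defP] : exists P, P = p%:Z ^+ k by exists (p%:Z ^+ k).
rewrite -defP in d11 d13 d22 d23.
have P0 : 0 < P by rewrite defP exprn_gt0 //; have := prime_gt0 pp; lia.
have pP : (p%:Z %| P)%Z by rewrite defP -(prednK k0) exprS dvdz_mulr.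
have Pdisc : (P %| qdisc q)%Z by rewrite defP dvdzE abszX /= pfactor_dvdnn.
have pPdisc : ~~ (P * p%:Z %| qdisc q)%Z.
  rewrite defP -exprSr dvdzE abszX /= pfactor_dvdn ?ltnn //.
  by rewrite absz_gt0 gt_eqF.
move: d11 d13 d22 d23 => /dvdzP[r11 e11] /dvdzP[r13 e13] /dvdzP[r22 e22] /dvdzP[r23 e23].
(* Modulo [P] the determinant reduces to [- q12^2 q33], and [q12] is a unit. *)
have d33 : (P %| q33 q)%Z.
  have : (P %| q12 q ^+ 2 * q33 q)%Z.
    have -> : q12 q ^+ 2 * q33 q = (4 * q11 q * q22 q * q33 q
        + q12 q * q13 q * q23 q - q11 q * q23 q ^+ 2 - q22 q * q13 q ^+ 2) - qdisc q.
      by rewrite qdiscE; ring.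
    rewrite rpredB // e11 e13 e22 e23; apply/dvdzP.
    exists (4 * r11 * (r22 * P) * q33 q + q12 q * r13 * (r23 * P)
      - r11 * (r23 * P) ^+ 2 - r22 * (r13 * P) ^+ 2); ring.
  rewrite Gauss_dvdzr // defP coprimez_pfactor //.
  by apply: contra p12 => /(dvdz_prime_exp pp).
have /dvdzP[r33 e33] := d33.
(* Otherwise [P * p] would divide the determinant, against the choice of [k]. *)
have pr33 : ~~ (p%:Z %| r33)%Z.
  apply: contra pPdisc => pr33.
  have -> : qdisc q = P * (P * (4 * r11 * r22 * (r33 * P) + q12 q * r13 * r23
      - r11 * r23 ^+ 2 * P - r22 * r13 ^+ 2 * P) - r33 * q12 q ^+ 2).
    by rewrite qdiscE e11 e13 e22 e23 e33; ring.
  by rewrite dvdz_mul // rpredB // dvdz_mulr.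
pose L (i : 'I_k.+1) := mat3 (p%:Z ^+ i) 0 0 0 (p%:Z ^+ (k - i)) 0 0 0 1.
pose q' (i : 'I_k.+1) := TQForm ((p%:Z ^+ i) ^+ 2 * r11) (q12 q) (p%:Z ^+ i * r13)
  ((p%:Z ^+ (k - i)) ^+ 2 * r22) (p%:Z ^+ (k - i) * r23) r33.
have PE (i : 'I_k.+1) : p%:Z ^+ i * p%:Z ^+ (k - i) = P.
  by rewrite -exprD subnKC ?defP // -ltnS.
have detL i : \det (L i) = P by rewrite /L det_diag3 mulr1 PE.
have qL i x : qeval q (L i *m x) = P * qeval (q' i) x.
  rewrite /L /q' qeval_diag3; move: (PE i); move: (p%:Z ^+ i) (p%:Z ^+ (k - i)) => A B AB.
  by rewrite /qeval /= e11 e13 e22 e23 e33 -AB; ring.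
have discE i : qdisc q = P * qdisc (q' i).
  apply: (@mulIf _ (P ^+ 2)); first by rewrite expf_neq0 // gt_eqF.
  by rewrite -{1}(detL i) (qdisc_subst (qL i)); ring.
have adm' i : admissible (q' i).
  apply: (admissible_subst pp (etrans (detL i) defP) P0 (qL i) _ adm).
  by move=> /dvdz_coefs [[_ d12 _] _]; rewrite /= d12 in p12.
have tauE : tau `|qdisc q| = (\sum_i tau `|qdisc (q' i)|)%N.
  set m := (`|qdisc q| %/ p ^ k)%N.
  have absP : `|P|%N = (p ^ k)%N by rewrite defP abszX.
  have Em : `|qdisc q|%N = (p ^ k * m)%N by rewrite mulnC divnK // pfactor_dvdnn.
  have Ei i : `|qdisc (q' i)|%N = m.
    by rewrite /m (discE i) abszM absP mulKn // expn_gt0 prime_gt0.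
  rewrite (eq_bigr (fun=> tau m)) => [|i _]; last by rewrite Ei.
  rewrite sum_nat_const card_ord Em tau_pfactor_mul //.
    by rewrite -(Ei ord0) absz_gt0; have [_ _ /gt_eqF ->] := adm' ord0.
  rewrite prime_coprime //; apply: contra pPdisc.
  by rewrite defP -exprSr dvdzE abszX Em /= expnSr dvdn_pmul2l // expn_gt0 prime_gt0.
apply: (@parametrizable_refine q _ L (fun=> P) (fun=> P) q').
- by rewrite gt_eqF.
- by move=> i; rewrite detL gt_eqF.
- exact: qL.
- by move=> i; rewrite detL; split=> //; rewrite exprS dvdz_mulr.
- move=> x px qx.
  have zeroE : q12 q * (x 0 0 * x 1 0) + P * (r11 * x 0 0 ^+ 2 + r13 * x 0 0 * x 2 0
      + r22 * x 1 0 ^+ 2 + r23 * x 1 0 * x 2 0 + r33 * x 2 0 ^+ 2) = 0.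
    by rewrite -qx /qeval e11 e13 e22 e23 e33; ring.
  have : (P %| q12 q * (x 0 0 * x 1 0)%R)%Z.
    by move/eqP: zeroE; rewrite addr_eq0 => /eqP ->; rewrite rpredN dvdz_mulr.
  rewrite defP Gauss_dvdzr ?coprimez_pfactor // => /(dvdz_pfactor_mul pp) [i ik [i0 i1]].
  have inL (j : 'I_k.+1) : in_image (L j) x <->
      (p%:Z ^+ j %| x 0%R 0%R)%Z /\ (p%:Z ^+ (k - j) %| x 1%R 0%R)%Z.
    by rewrite /L in_image_diag3 dvd1z; split=> [[] | []].
  (* For [j < j'], a point of both lattices has [p] dividing [x1] and [x2], and [P * p] dividing
     [x1 x2]. Dividing the equation by [P] gives [p] dividing [r33 x3^2], hence [x3], against
     primitivity. *)
  have ltP (j j' : 'I_k.+1) : in_image (L j) x -> in_image (L j') x -> ~ (j < j')%N.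
    move=> /inL [_ /dvdzP [y1 ey1]] /inL [/dvdzP [y0 ey0] _] jj'.
    have ej' : p%:Z ^+ j' = p%:Z ^+ j * p%:Z * p%:Z ^+ (j' - j.+1).
      by rewrite -exprSr -exprD subnKC.
    have p0x : (p%:Z %| x 0%R 0%R)%Z.
      by rewrite ey0 ej' dvdz_mull // -mulrA dvdz_mull // dvdz_mulr.
    have p1x : (p%:Z %| x 1%R 0%R)%Z.
      have := ltn_ord j'; rewrite ltnS => j'k.
      have jk : (0 < k - j)%N by rewrite subn_gt0 (leq_trans jj').
      by rewrite ey1 dvdz_mull // -(prednK jk) exprS dvdz_mulr.
    apply: (primitive_vec_prime pp px); split=> //.
    have : (p%:Z %| r33 * x 2%R 0%R ^+ 2)%Z.
      have [y0' ey0'] := dvdzP p0x; have [y1' ey1'] := dvdzP p1x.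
      have := gt_eqF P0; move/negbT => Pn0.
      apply/dvdzP; exists (- (q12 q * y0 * y1 * p%:Z ^+ (j' - j.+1) + r11 * y0' * x 0 0
         + r13 * y0' * x 2 0 + r22 * y1' * x 1 0 + r23 * y1' * x 2 0)).
      apply: (mulfI Pn0); move/eqP: zeroE; rewrite addr_eq0 => /eqP zeroE.
      transitivity (- (q12 q * (y0 * y1 * (p%:Z ^+ j * p%:Z * p%:Z ^+ (j' - j.+1)
          * p%:Z ^+ (k - j)))) - P * (r11 * (y0' * p%:Z) * x 0 0
          + r13 * (y0' * p%:Z) * x 2 0 + r22 * (y1' * p%:Z) * x 1 0
          + r23 * (y1' * p%:Z) * x 2 0)).
        rewrite -ej' -ey0' -ey1'.
        have -> : y0 * y1 * (p%:Z ^+ j' * p%:Z ^+ (k - j)) = x 0 0 * x 1 0.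
          by rewrite ey0 ey1 mulrACA.
        by rewrite zeroE; ring.
      rewrite -(PE j).
      move: (p%:Z ^+ j) (p%:Z ^+ (k - j)) (p%:Z ^+ (j' - j.+1)) => A B C.
      by ring.
    rewrite dvdz_prime_mul // (negPf pr33) => /(dvdz_prime_exp pp); exact.
  exists (Ordinal (ik : (i < k.+1)%N)); split=> [|j xj]; first exact/inL.
  have xi : in_image (L (Ordinal (ik : (i < k.+1)%N))) x by exact/inL.
  move: (ltP _ _ xi xj) (ltP _ _ xj xi) => /= /negP ij /negP ji.
  by apply: val_inj; apply/eqP; rewrite eqn_leq leqNgt ji leqNgt ij.
- by rewrite tauE.
- by rewrite tauE.
- move=> i; apply: IH => //; have [_ _ disc'0] := adm' i.
  rewrite (discE i) abszM; have : (1 < `|P|)%N by rewrite defP abszX -(exp1n k) ltn_exp2r // prime_gt1.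
  by move=> P1; apply: ltn_Pmull; rewrite // absz_gt0 gt_eqF.
Qed.

Lemma parametrizable_hyperbolic p q : prime p -> admissible q ->
  (p%:Z %| qdisc q)%Z -> hyperbolic_mod p p%:Z 1 q ->
  (forall r, admissible r -> (`|qdisc r| < `|qdisc q|)%N -> parametrizable r) ->
  parametrizable q.
Proof.
move=> pp adm pdisc hq IH; have [_ _ disc0] := adm.
have k0 : (0 < logn p `|qdisc q|)%N.
  by rewrite logn_gt0 mem_primes pp absz_gt0 gt_eqF //=; rewrite dvdzE in pdisc.
have [q' eqv] := hyperbolic_lift (logn p `|qdisc q|).-1 pp hq; rewrite prednK // => h'.
have q0 : qdisc q != 0 by rewrite gt_eqF.
apply: (equivalent_parametrizable q0 eqv).
have Ed := equivalent_qdisc eqv; rewrite Ed in k0 IH h'.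
exact: (parametrizable_hyperbolic_pow pp (equivalent_admissible eqv adm)).
Qed.

(** * Forms that are a multiple of a square modulo a prime *)

(** Primitivity makes [q11] a unit modulo [p], so every zero has [p] dividing [x1]. On that lattice
    the form is divided by [p ^ 2] if possible, else by [p], and the determinant loses [p ^ 4] or
    [p]. The loss [p ^ 4] is why [parametrized_by] has the exponent 4. *)
Lemma parametrizable_square p q : prime p -> admissible q ->
  [/\ (p%:Z %| q12 q)%Z, (p%:Z %| q13 q)%Z, (p%:Z %| q22 q)%Z,
      (p%:Z %| q23 q)%Z & (p%:Z %| q33 q)%Z] ->
  (forall r, admissible r -> (`|qdisc r| < `|qdisc q|)%N -> parametrizable r) ->
  parametrizable q.
Proof.
move=> pp adm [d12 d13 d22 d23 d33] IH.
have p1 : 1 < p%:Z by have := prime_gt1 pp; lia.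
have p0 : 0 < p%:Z by have := prime_gt0 pp; lia.
have p11 : ~~ (p%:Z %| q11 q)%Z.
  by apply/negP => d11; have [/(_ p pp) prim _ _] := adm; apply: prim; apply/dvdz_coefs.
have detL : \det (mat3 p%:Z 0 0 0 1 0 0 0 1) = p%:Z ^+ 1.
  by rewrite det_diag3 !mulr1.
have p2disc : (p%:Z ^+ 2 %| qdisc q)%Z.
  rewrite qdiscE; move: d12 d13 d22 d23 d33.
  move=> /dvdzP[r12 ->] /dvdzP[r13 ->] /dvdzP[r22 ->] /dvdzP[r23 ->] /dvdzP[r33 ->].
  apply/dvdzP; exists (4 * q11 q * r22 * r33 + r12 * r13 * r23 * p%:Z
    - q11 q * r23 ^+ 2 - r22 * r13 ^+ 2 * p%:Z - r33 * r12 ^+ 2 * p%:Z).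
  by ring.
have cover x : primitive_vec x -> qeval q x = 0 ->
    in_image (mat3 p%:Z 0 0 0 1 0 0 0 1) x.
  move=> _ qx; apply/in_image_diag3; rewrite !dvd1z; split=> //.
  have : (p%:Z %| q11 q * x 0%R 0%R ^+ 2)%Z.
    have -> : q11 q * x 0 0 ^+ 2 = qeval q x - (q12 q * (x 0 0 * x 1 0)
      + q13 q * (x 0 0 * x 2 0) + q22 q * x 1 0 ^+ 2 + q23 q * (x 1 0 * x 2 0)
      + q33 q * x 2 0 ^+ 2) by rewrite /qeval; ring.
    by rewrite qx sub0r rpredN !rpredD // dvdz_mulr.
  by rewrite dvdz_prime_mul // (negPf p11) => /(dvdz_prime_exp pp).
have /dvdzP[r12 e12] := d12; have /dvdzP[r13 e13] := d13.
have [/and3P[D22 D23 D33] | nD] := boolP [&& (p%:Z ^+ 2 %| q22 q)%Z,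
    (p%:Z ^+ 2 %| q23 q)%Z & (p%:Z ^+ 2 %| q33 q)%Z].
  move: D22 D23 D33 => /dvdzP[r22 e22] /dvdzP[r23 e23] /dvdzP[r33 e33].
  apply: (@parametrizable_descent q (TQForm (q11 q) r12 r13 r22 r23 r33)
    _ (p%:Z ^+ 2) (p%:Z ^+ 4) p 1 pp adm detL) => //.
  - by rewrite exprn_gt0.
  - by move=> x; rewrite qeval_diag3 /qeval /= e12 e13 e22 e23 e33; ring.
  - by move=> /dvdz_coefs [[d11 _ _] _]; rewrite /= d11 in p11.
  - by rewrite detL -!exprM -exprD.
  - by rewrite detL dvdz_exp2l.
  - by rewrite detL expr1.
  - by rewrite exprn_egt1.
move: d22 d23 d33 => /dvdzP[r22 e22] /dvdzP[r23 e23] /dvdzP[r33 e33].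
apply: (@parametrizable_descent q (TQForm (p%:Z * q11 q) (q12 q) (q13 q) r22 r23 r33)
  _ p%:Z p%:Z p 1 pp adm detL) => //.
- by move=> x; rewrite qeval_diag3 /qeval /= e22 e23 e33; ring.
- move=> /dvdz_coefs [_ /= [d22 d23 d33]]; move/negP: nD; apply.
  by rewrite e22 e23 e33 expr2 !dvdz_mul.
- by rewrite detL -exprM -exprS.
- by rewrite detL expr1.
- by rewrite detL expr1 exprS dvdz_mulr.
Qed.

(** * Primitive zeros, and the anisotropic case *)

Lemma isotropic_primitive q : isotropic q ->
  exists2 x, primitive_vec x & qeval q x = 0.
Proof.
move=> [x [x0 qx]]; pose g := gcdz (gcdz (x 0 0) (x 1 0)) (x 2 0).
have gx i : (g %| x i 0%R)%Z.
  have g01 : (g %| gcdz (x 0%R 0%R) (x 1%R 0%R))%Z by exact: dvdz_gcdl.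
  elim/ord3P: i; last exact: dvdz_gcdr.
    exact: dvdz_trans g01 (dvdz_gcdl _ _).
  exact: dvdz_trans g01 (dvdz_gcdr _ _).
have g0 : g != 0.
  apply: contra x0 => /eqP g0; apply/eqP/matrixP => i j.
  by rewrite (ord1 j) mxE; apply/eqP; rewrite -dvd0z -g0.
pose y : 'cV[int]_3 := \col_i (x i 0%R %/ g)%Z.
have xy : x = g *: y.
  by apply/matrixP => i j; rewrite (ord1 j) !mxE mulrC divzK.
exists y => [d dy|]; last first.
  by move/eqP: qx; rewrite xy qevalZ mulf_eq0 expf_eq0 (negPf g0) => /eqP.
have gdx i : (g * d %| x i 0%R)%Z by rewrite xy mxE dvdz_mul2l.
have : (g * d %| g * 1%R)%Z by rewrite mulr1 {2}/g !dvdz_gcd !gdx.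
by rewrite dvdz_mul2l // dvdz1; lia.
Qed.

(** If [t] were a unit modulo [p], then [s / t] would be a root of the polynomial. *)
Lemma anisotropic_mod_prime p (a b c s t : int) : prime p ->
  ~~ (p%:Z %| a)%Z -> (forall r, ~~ (p%:Z %| a * r ^+ 2 + b * r + c)%Z) ->
  (p%:Z %| a * s ^+ 2 + b * s * t + c * t ^+ 2)%Z ->
  (p%:Z %| s)%Z /\ (p%:Z %| t)%Z.
Proof.
move=> pp pa noroot pf; suff pt : (p%:Z %| t)%Z.
  split=> //; apply: (@dvdz_prime_exp p s 2) => //.
  suff : (p%:Z %| a * s ^+ 2)%Z by rewrite dvdz_prime_mul // (negPf pa).
  have -> : a * s ^+ 2 = (a * s ^+ 2 + b * s * t + c * t ^+ 2) - (b * s + c * t) * t by ring.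
  by rewrite rpredB // dvdz_mull.
apply/negPn/negP => pt; have [u [v uv]] := inverse_mod pp pt.
move/negP: (noroot (s * u)); apply.
have -> : a * (s * u) ^+ 2 + b * (s * u) + c
  = u ^+ 2 * (a * s ^+ 2 + b * s * t + c * t ^+ 2)
    + (1 - t * u) * (b * s * u + c * (1 + t * u)) by ring.
apply: rpredD; [exact: dvdz_mull | rewrite dvdz_mulr // uv].
by apply/dvdzP; exists (- v); ring.
Qed.

Lemma parametrizable_anisotropic p q : prime p -> admissible q ->
  [/\ (p%:Z %| q13 q)%Z, (p%:Z %| q23 q)%Z & (p%:Z %| q33 q)%Z] ->
  ~~ (p%:Z %| q11 q)%Z ->
  (forall r, ~~ (p%:Z %| q11 q * r ^+ 2 + q12 q * r + q22 q)%Z) ->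
  (forall r, admissible r -> (`|qdisc r| < `|qdisc q|)%N -> parametrizable r) ->
  parametrizable q.
Proof.
move=> pp adm [d13 d23 d33] p11 noroot IH.
have p1 : 1 < p%:Z by have := prime_gt1 pp; lia.
have p0 : 0 < p%:Z by have := prime_gt0 pp; lia.
have zero x : qeval q x = 0 -> (p%:Z %| x 0%R 0%R)%Z /\ (p%:Z %| x 1%R 0%R)%Z.
  move=> qx; apply: (anisotropic_mod_prime pp p11 noroot).
  have -> : q11 q * x 0 0 ^+ 2 + q12 q * x 0 0 * x 1 0 + q22 q * x 1 0 ^+ 2
    = qeval q x - (q13 q * (x 0 0 * x 2 0) + q23 q * (x 1 0 * x 2 0)
                   + q33 q * x 2 0 ^+ 2) by rewrite /qeval; ring.
  by rewrite qx sub0r rpredN !rpredD // dvdz_mulr.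
(* Isotropy enters here: a primitive zero has [p] dividing [x1] and [x2] but not [x3], and modulo
   [p ^ 2] its equation leaves only [q33 x3^2]. *)
have D33 : (p%:Z ^+ 2 %| q33 q)%Z.
  have [_ /isotropic_primitive [x px qx] _] := adm.
  have [x0 x1] := zero x qx.
  have x2 : ~~ (p%:Z %| x 2%R 0%R)%Z.
    by apply/negP => x2; apply: (primitive_vec_prime pp px).
  have : (p%:Z ^+ 2 %| q33 q * x 2%R 0%R ^+ 2)%Z.
    have -> : q33 q * x 2 0 ^+ 2 = qeval q x - (q11 q * x 0 0 ^+ 2
      + q12 q * (x 0 0 * x 1 0) + q13 q * x 0 0 * x 2 0 + q22 q * x 1 0 ^+ 2
      + q23 q * x 1 0 * x 2 0) by rewrite /qeval; ring.
    rewrite qx sub0r rpredN !rpredD // ?[_ * x 2 0]mulrC dvdz_mull //;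
      by rewrite expr2 dvdz_mul.
  rewrite Gauss_dvdzl // coprimez_pfactor //.
  by apply: contra x2 => /(dvdz_prime_exp pp).
move: d13 d23 D33 => /dvdzP[r13 e13] /dvdzP[r23 e23] /dvdzP[r33 e33].
have detL : \det (mat3 p%:Z 0 0 0 p%:Z 0 0 0 1) = p%:Z ^+ 2.
  by rewrite det_diag3 mulr1.
apply: (@parametrizable_descent q (TQForm (q11 q) (q12 q) r13 (q22 q) r23 r33)
  _ (p%:Z ^+ 2) (p%:Z ^+ 2) p 2 pp adm detL) => //.
- by rewrite exprn_gt0.
- by move=> x; rewrite qeval_diag3 /qeval /= e13 e23 e33; ring.
- by move=> /dvdz_coefs [[d11 _ _] _]; rewrite /= d11 in p11.
- by rewrite detL -!exprM -exprD.
- by rewrite detL.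
- by rewrite detL exprS dvdz_mulr.
- by rewrite exprn_egt1.
- rewrite qdiscE e13 e23 e33; apply/dvdzP.
  exists (4 * q11 q * q22 q * r33 + q12 q * r13 * r23 - q11 q * r23 ^+ 2
    - q22 q * r13 ^+ 2 - r33 * q12 q ^+ 2); ring.
- by move=> x _ /zero [x0 x1]; apply/in_image_diag3; rewrite dvd1z.
Qed.

(** * Case distinction modulo a prime, and the induction *)

(** A root depends only on its residue, so a search over ['I_p] decides the alternative. *)
Lemma root_mod_prime_dec p (a b c : int) : prime p ->
  (exists r, (p%:Z %| a * r ^+ 2 + b * r + c)%Z) \/
  (forall r, ~~ (p%:Z %| a * r ^+ 2 + b * r + c)%Z).
Proof.
move=> pp; have p0 : 0 < p%:Z by have := prime_gt0 pp; lia.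
have [/existsP[r rP] | noroot] :=
    boolP [exists r : 'I_p, (p%:Z %| a * r%:Z ^+ 2 + b * r%:Z + c)%Z].
  by left; exists r%:Z.
right=> r; apply: contra noroot => rP.
have r0 : 0 <= (r %% p)%Z by rewrite modz_ge0 // gt_eqF.
have rp : (`|(r %% p)%Z| < p)%N by have := ltz_pmod r p0; lia.
apply/existsP; exists (Ordinal rp) => /=; rewrite gez0_abs //.
have -> : a * (r %% p)%Z ^+ 2 + b * (r %% p)%Z + c = a * r ^+ 2 + b * r + c
    - (r - (r %% p)%Z) * (a * (r + (r %% p)%Z) + b) by ring.
rewrite rpredB // dvdz_mulr //.
by apply/dvdzP; exists (r %/ p)%Z; rewrite {1}(divz_eq r p) addrK.
Qed.

Lemma parametrizable_binary p q : prime p -> admissible q ->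
  (p%:Z %| qdisc q)%Z ->
  [/\ (p%:Z %| q13 q)%Z, (p%:Z %| q23 q)%Z & (p%:Z %| q33 q)%Z] ->
  (forall r, admissible r -> (`|qdisc r| < `|qdisc q|)%N -> parametrizable r) ->
  parametrizable q.
Proof.
move=> pp adm pdisc [d13 d23 d33] IH.
have q0 : qdisc q != 0 by have [_ _ /gt_eqF ->] := adm.
(* Once [p] divides [q22], the coefficient [q12] decides between the square and hyperbolic cases. *)
suff red q1 : equivalent q q1 -> [/\ (p%:Z %| q13 q1)%Z, (p%:Z %| q22 q1)%Z,
    (p%:Z %| q23 q1)%Z & (p%:Z %| q33 q1)%Z] -> parametrizable q.
  have [d11 | d11] := boolP (p%:Z %| q11 q)%Z.
    by apply: red (equivalent_swap q) _; rewrite /= rpredN.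
  have [[r rP] | noroot] := root_mod_prime_dec (q11 q) (q12 q) (q22 q) pp.
    (* The shear by [r] turns [q22] into the value of the polynomial at its root [r]. *)
    apply: red (equivalent_shear q r 0) _ => /=.
    split.
    - by rewrite mulr0 mul0r addr0.
    - suff -> : q22 q + r * q12 q + r ^+ 2 * q11 q
        = q11 q * r ^+ 2 + q12 q * r + q22 q by [].
      by ring.
    - by rewrite mul0r addr0 mulr0 mul0r addr0 rpredD // dvdz_mull.
    - by rewrite mul0r addr0 expr0n mul0r addr0.
  exact: parametrizable_anisotropic pp adm _ d11 noroot IH.
move=> eqv [e13 e22 e23 e33].
have adm1 := equivalent_admissible eqv adm.
apply: (equivalent_parametrizable q0 eqv).
rewrite (equivalent_qdisc eqv) in pdisc IH q0.
have [e12 | e12] := boolP (p%:Z %| q12 q1)%Z.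
  exact: parametrizable_square pp adm1 _ IH.
(* The swap moves the divisibility to [q11] and [q13], where [hyperbolic_mod p p 1] asks for it. *)
have eqv2 := equivalent_swap q1.
apply: (equivalent_parametrizable q0 eqv2).
have adm2 := equivalent_admissible eqv2 adm1.
rewrite (equivalent_qdisc eqv2) in pdisc IH.
apply: parametrizable_hyperbolic pp adm2 pdisc _ IH.
by split; rewrite /= ?rpredN ?dvd1z.
Qed.

Lemma admissible_parametrizable q : admissible q -> parametrizable q.
Proof.
have [n] := ubnP `|qdisc q|%N; elim: n q => // n IHn q lt_n adm.
have [prim iso disc0] := adm.
have q0 : qdisc q != 0 by rewrite gt_eqF.
have [disc1 | disc1] := eqVneq (qdisc q) 1; first exact: parametrizable_disc1.
have [p pp pdisc] : exists2 p, prime p & (p%:Z %| qdisc q)%Z.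
  by exists (pdiv `|qdisc q|); rewrite ?dvdzE ?pdiv_dvd ?pdiv_prime //; lia.
have IH r : admissible r -> (`|qdisc r| < `|qdisc q|)%N -> parametrizable r.
  by move=> admr ltr; apply: IHn => //; apply: leq_trans ltr _.
have [a [b [c [d eqv]]]] := isotropic_normal_form iso.
apply: (equivalent_parametrizable q0 eqv).
have adm1 := equivalent_admissible eqv adm.
rewrite (equivalent_qdisc eqv) in pdisc IH q0.
(* If [p] does not divide [a], the zero coefficients [q11] and [q13] already give the hyperbolic
   shape. *)
have [pa | pa] := boolP (p%:Z %| a)%Z; last first.
  by apply: parametrizable_hyperbolic pp adm1 pdisc _ IH; split; rewrite /= ?dvdz0 ?dvd1z.
(* If [p] divides [a], the isotropic first basis vector is in the radical modulo [p]; the rotation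
   moves it to third place, leaving a binary form in [x1], [x2]. *)
have eqv2 := equivalent_rot (TQForm 0 a 0 b c d).
apply: (equivalent_parametrizable q0 eqv2).
have adm2 := equivalent_admissible eqv2 adm1.
rewrite (equivalent_qdisc eqv2) in pdisc IH.
by apply: parametrizable_binary pp adm2 pdisc _ IH; rewrite /= dvdz0.
Qed.

(** * Primitive zeros in the image of a matrix *)

Definition conic_point (s t : int) : 'cV[int]_3 := vec3 (s ^+ 2) (s * t) (t ^+ 2).

Lemma conic_pointE (M : 'M[int]_3) s t i : (M *m conic_point s t) i 0 =
  M i 0 * s ^+ 2 + M i 1 * (s * t) + M i 2 * t ^+ 2.
Proof. by rewrite mulmx3E !vec3E. Qed.

Lemma conic_point_nonzero_mod p (M : 'M[int]_3) :
  ~~ [forall i, forall j, (p%:Z %| M i j)%Z] ->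
  exists s t, ~~ [forall i, (p%:Z %| (M *m conic_point s t)%R i 0%R)%Z].
Proof.
move=> pM.
have [/forallP p10 | ?] := boolP [forall i, (p%:Z %| (M *m conic_point 1 0)%R i 0%R)%Z];
  last by exists 1, 0.
have [/forallP p01 | ?] := boolP [forall i, (p%:Z %| (M *m conic_point 0 1)%R i 0%R)%Z];
  last by exists 0, 1.
exists 1, 1; apply: contra pM => /forallP p11; apply/forallP => i; apply/forallP => j.
have e0 : M i 0 = (M *m conic_point 1 0) i 0 by rewrite conic_pointE; ring.
have e2 : M i 2 = (M *m conic_point 0 1) i 0 by rewrite conic_pointE; ring.
have e1 : M i 1 = (M *m conic_point 1 1) i 0 - M i 0 - M i 2.
  by rewrite conic_pointE; ring.
by elim/ord3P: j; rewrite ?e1 ?e0 ?e2 ?rpredB.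
Qed.

(** Only the residues of [s] and [t] matter at each prime, so the choice for a new prime is glued to
    the earlier one modulo the product [N] of the list. *)
Lemma conic_point_nonzero_mod_all (M : 'M[int]_3) (l : seq nat) :
  all prime l ->
  (forall p, p \in l -> ~~ [forall i, forall j, (p%:Z %| M i j)%Z]) ->
  exists s t, forall p, p \in l ->
    ~~ [forall i, (p%:Z %| (M *m conic_point s t)%R i 0%R)%Z].
Proof.
elim: l => [|p l IH] /=; first by exists 0, 0.
move=> /andP[pp prl] pM; have [|s [t st]] := IH prl.
  by move=> r rl; apply: pM; rewrite inE rl orbT.
have [pl | npl] := boolP (p \in l).
  by exists s, t => r; rewrite inE => /orP[/eqP-> | rl]; apply: st.
have [s1 [t1 st1]] := conic_point_nonzero_mod (pM p (mem_head p l)).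
pose N := (\prod_(r <- l) r)%N.
have dvdN r : r \in l -> (r %| N)%N by move=> rl; rewrite /N (big_rem r) //= dvdn_mulr.
have cop : coprimez N%:Z p%:Z.
  rewrite coprimezE /= coprime_sym prime_coprime // Euclid_dvd_prod //.
  rewrite big_has; apply/hasPn => r rl; rewrite dvdn_prime2 //; last exact: (allP prl).
  by apply: contraNneq npl => ->.
have cong (r : nat) s2 t2 s3 t3 : (r%:Z %| s3 - s2)%Z -> (r%:Z %| t3 - t2)%Z ->
    ~~ [forall i, (r%:Z %| (M *m conic_point s2 t2)%R i 0%R)%Z] ->
    ~~ [forall i, (r%:Z %| (M *m conic_point s3 t3)%R i 0%R)%Z].
  move=> ds dt; apply: contra => /forallP d3; apply/forallP => i.
  have -> : (M *m conic_point s2 t2) i 0 = (M *m conic_point s3 t3) i 0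
      - (s3 - s2) * (M i 0 * (s3 + s2) + M i 1 * t2)
      - (t3 - t2) * (M i 1 * s3 + M i 2 * (t3 + t2)).
    by rewrite !conic_pointE; ring.
  by rewrite !rpredB // dvdz_mulr.
exists (zchinese N%:Z p%:Z s s1), (zchinese N%:Z p%:Z t t1) => r.
rewrite inE => /orP[/eqP-> | rl].
  by apply: cong st1; rewrite -eqz_mod_dvd; apply/eqP; rewrite zchinese_modr.
have rN : (r%:Z %| N%:Z)%Z by rewrite dvdzE; apply: dvdN.
by apply: cong (st r rl); apply: (dvdz_trans rN); rewrite -eqz_mod_dvd;
  apply/eqP; rewrite zchinese_modl.
Qed.

(** The choice of [s, t] handles the primes dividing [\det M]. Any other prime dividing the image
    vector divides the conic point, through [\adj M], hence both parameters; making these coprime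
    excludes it. *)
Lemma primitive_conic_point (M : 'M[int]_3) : \det M != 0 ->
  (forall p, prime p -> ~~ [forall i, forall j, (p%:Z %| M i j)%Z]) ->
  exists s t, primitive_vec (M *m conic_point s t).
Proof.
move=> M0 pM; have prl : all prime (primes `|\det M|).
  by apply/allP => p; rewrite mem_primes => /and3P[].
have [|s [t st]] := @conic_point_nonzero_mod_all M _ prl.
  by move=> p /(allP prl); apply: pM.
(* Removing the common factor [g] divides the vector by [g ^+ 2], so a prime dividing the new vector
   divides the old one. *)
have [g [s' [t' [u [v [Es Et uv]]]]]] := gcd_cofactors s t.
exists s', t' => d dy; rewrite leNgt; apply/negP => d1.
have [p pp pd] : exists2 p, prime p & (p%:Z %| d)%Z.
  by exists (pdiv `|d|); rewrite ?dvdzE ?pdiv_dvd ?pdiv_prime //; lia.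
have py i : (p%:Z %| (M *m conic_point s' t')%R i 0%R)%Z.
  exact: dvdz_trans pd (dy i).
have [pdet | pdet] := boolP (p%:Z %| \det M)%Z.
  have pl : p \in primes `|\det M|.
    by rewrite mem_primes pp absz_gt0 M0; rewrite dvdzE in pdet.
  move/negP: (st p pl); apply; apply/forallP => i.
  have -> : (M *m conic_point s t) i 0 = g ^+ 2 * (M *m conic_point s' t') i 0.
    by rewrite !conic_pointE Es Et; ring.
  by rewrite dvdz_mull.
have pconic i : (p%:Z %| conic_point s' t' i 0%R)%Z.
  suff : (p%:Z %| \det M * conic_point s' t' i 0%R)%Z.
    by rewrite dvdz_prime_mul // (negPf pdet).
  have -> : \det M * conic_point s' t' i 0 = (\adj M *m (M *m conic_point s' t')) i 0.
    by rewrite mulmxA mul_adj_mx mul_scalar_mx [RHS]mxE.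
  by rewrite mxE rpred_sum // => j _; rewrite dvdz_mull.
have ps : (p%:Z %| s')%Z.
  by apply: (@dvdz_prime_exp p s' 2) => //; have := pconic 0; rewrite vec3E.
have pt : (p%:Z %| t')%Z.
  by apply: (@dvdz_prime_exp p t' 2) => //; have := pconic 2; rewrite vec3E.
have : (p%:Z %| 1%R)%Z by rewrite -uv rpredD // dvdz_mull.
by rewrite dvdzE /= Euclid_dvd1.
Qed.

Lemma cube_free_entries (M : 'M[int]_3) (n : int) (p : nat) :
  power_free 3 `|n| -> (\det M %| n)%Z -> prime p ->
  ~~ [forall i, forall j, (p%:Z %| M i j)%Z].
Proof.
move=> cf Mn pp; apply/negP => /forallP pM.
have EM : M = p%:Z *: \matrix_(i, j) (M i j %/ p%:Z)%Z.
  apply/matrixP => i j; rewrite !mxE mulrC divzK //.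
  by move: (pM i) => /forallP.
have : (p%:Z ^+ 3 %| n)%Z by apply: dvdz_trans Mn; rewrite EM detZ dvdz_mulr.
by rewrite dvdzE abszX => /cf /= p1; move: pp; rewrite p1.
Qed.

(** * Valuations, and assembly of the clauses *)

(** Let [a], [b] be the valuations of [n], [m]. Since 3 divides [a + 2b], [a] and [b] are congruent
    modulo 3, so [a > b] gives [a >= b + 3]; and [0 < a <= 4b] gives [b >= 1]. *)
Lemma logn_disc_det p (n m d : nat) : prime p -> (0 < n)%N -> (0 < m)%N ->
  (m %| n)%N -> (n %| m ^ 4)%N -> (n * m ^ 2 = d ^ 3)%N -> (p %| n %/ m)%N ->
  (4 <= logn p n)%N.
Proof.
move=> pp n0 m0 mn nm nmd pnm.
have l1 := dvdn_leq_log p n0 mn.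
have l2 : (logn p n <= 4 * logn p m)%N.
  by rewrite -lognX; apply: dvdn_leq_log nm; rewrite expn_gt0 m0.
have l3 : (logn p n + 2 * logn p m = 3 * logn p d)%N.
  by rewrite -!lognX -lognM ?nmd ?expn_gt0 ?m0.
have l4 : (0 < logn p n - logn p m)%N.
  by rewrite -logn_div // logn_gt0 mem_primes pp pnm divn_gt0 // dvdn_leq.
lia.
Qed.

Theorem theorem1 (q : tqform) :
  primitive_form q -> isotropic q -> 0 < qdisc q ->
  exists (K : nat) (M : 'I_K -> 'M[int]_3) (D : 'I_K -> nat),
    [/\ (0 < K)%N, (K <= tau `|qdisc q|%N)%N
      & forall k : 'I_K, \det (M k) != 0] /\
    (* (i) *)
    (power_free 2 `|qdisc q|%N -> K = tau `|qdisc q|%N) /\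
    (* (ii) *)
    (forall k : 'I_K, 0 < \det (M k) /\ (\det (M k) %| qdisc q)%Z) /\
    (* (iii) *)
    (forall x : 'cV[int]_3, primitive_vec x -> qeval q x = 0 ->
       exists! k : 'I_K, in_image (M k) x) /\
    (* (iv) *)
    (forall k : 'I_K, (0 < D k)%N /\
       forall x : 'cV[int]_3,
         qeval q (M k *m x) = (D k)%:Z * (x 0 0 * x 2 0 - x 1 0 ^+ 2)) /\
    (* (v) *)
    (forall k : 'I_K,
       [/\ qdisc q * \det (M k) ^+ 2 = (D k)%:Z ^+ 3,
           ((D k)%:Z %| qdisc q)%Z,
           (\det (M k) %| (D k)%:Z)%Z
         & ((D k)%:Z %| \det (M k) ^+ 2)%Z]) /\
    (* (vi) *)
    (forall (k : 'I_K) (p : nat), prime p ->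
       (p%:Z %| (qdisc q %/ \det (M k)))%Z ->
       (4 <= logn p `|qdisc q|%N)%N) /\
    (* (vii) *)
    (power_free 3 `|qdisc q|%N ->
       forall k : 'I_K, exists x : 'cV[int]_3,
         [/\ primitive_vec x, qeval q x = 0 & in_image (M k) x]).
Proof.
move=> /primitive_form_at_primes prim iso disc0.
have [K [M0 [D0 [[Kle Keq] Mdvd MD cover]]]] :
  parametrizable q by apply: admissible_parametrizable.
rewrite card_ord in Kle Keq.
(* In odd dimension a change of sign negates the determinant, while it preserves the image and the
   values of [q]; this makes all determinants positive. *)
pose sg k : int := if 0 < \det (M0 k) then 1 else -1.
have sg2 k : sg k ^+ 2 = 1 by rewrite /sg; case: ifP.
pose M k := sg k *: M0 k.
have imM k x : in_image (M k) x <-> in_image (M0 k) x.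
  split=> -[y ->]; exists (sg k *: y); rewrite /M -scalemxAr -scalemxAl //.
  by rewrite scalerA -expr2 sg2 scale1r.
have det0 k : \det (M0 k) != 0.
  apply/eqP => d0; have [] := Mdvd k; rewrite d0 dvd0z => /eqP E.
  by rewrite E in disc0.
have detM k : \det (M k) = `|\det (M0 k)|.
  rewrite detZ /sg; case: ltP => [dpos | dneg].
    by rewrite expr1n mul1r gtr0_norm.
  by rewrite ler0_norm // exprS sqrrN expr1n mulr1 mulN1r.
have MD' k x : qeval q (M k *m x) = D0 k * (x 0 0 * x 2 0 - x 1 0 ^+ 2).
  by rewrite -scalemxAl qevalZ sg2 mul1r MD.
(* [q0] is [x1 x3 - x2^2], of determinant 1. *)
pose q0 := TQForm 0 0 1 (-1) 0 0.
have disc_det k : qdisc q * \det (M k) ^+ 2 = D0 k ^+ 3.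
  rewrite (@qdisc_subst q q0 (M k) (D0 k)).
    by rewrite [qdisc q0]qdiscE /=; ring.
  by move=> x; rewrite MD' /qeval /=; ring.
have detpos k : 0 < \det (M k) by rewrite detM normr_gt0.
have D0pos k : 0 < D0 k.
  have : 0 < D0 k ^+ 3 by rewrite -disc_det mulr_gt0 // exprn_gt0.
  by rewrite exprn_odd_gt0.
have DE k : `|D0 k|%N%:Z = D0 k by rewrite gez0_abs // ltW.
have detdvd k : (\det (M k) %| qdisc q)%Z.
  by rewrite detM -abszE dvdzE absz_nat -dvdzE; have [] := Mdvd k.
have dvddet k : (qdisc q %| \det (M k) ^+ 4)%Z.
  by have [_] := Mdvd k; rewrite detM -normrX -abszE !dvdzE absz_nat.
have cover' x : primitive_vec x -> qeval q x = 0 -> exists! k, in_image (M k) x.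
  move=> px qx; have [k [xk uk]] := cover x px qx; exists k.
  by split=> [|k' /imM]; [apply/imM | apply: uk].
exists K, M, (fun k => `|D0 k|%N); split; [|split; [|split; [|split; [|split; [|split; [|split]]]]]].
- split=> // [|k]; last by rewrite gt_eqF.
  (* The index that covers a primitive zero shows that [K] is positive. *)
  have [x px qx] := isotropic_primitive iso; have [k _] := cover' x px qx.
  exact: leq_ltn_trans (ltn_ord k).
- exact: Keq.
- by [].
- exact: cover'.
- by move=> k; rewrite absz_gt0 gt_eqF //; split=> // x; rewrite DE.
(* The divisibilities are checked on cubes, with [D ^ 3] replaced by the determinant times
   [\det (M k) ^+ 2]; the last one uses [dvddet]. *)
- move=> k; rewrite DE; split=> //.
  + rewrite -(@dvdz_pexp2r _ _ 3) // -disc_det [qdisc q ^+ 3]exprS.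
    by rewrite dvdz_mul // dvdz_exp2r.
  + rewrite -(@dvdz_pexp2r _ _ 3) // -disc_det exprS.
    by rewrite dvdz_mul.
  + rewrite -(@dvdz_pexp2r _ _ 3) // -disc_det -exprM -[(2 * 3)%N]/(4 + 2)%N exprD.
    by rewrite dvdz_mul.
- move=> k p pp pdiv.
  apply: (@logn_disc_det p _ `|\det (M k)| `|D0 k|) => //.
  + by rewrite absz_gt0 gt_eqF.
  + by rewrite absz_gt0 gt_eqF.
  + by have := detdvd k; rewrite dvdzE.
  + by have := dvddet k; rewrite dvdzE abszX.
  + by rewrite -!abszX -abszM disc_det.
  + have [c Ec] := dvdzP (detdvd k); move: pdiv; rewrite Ec mulzK ?gt_eqF //.
    by rewrite abszM mulnK ?absz_gt0 ?gt_eqF // dvdzE.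
- move=> cf k.
  have detn0 : \det (M k) != 0 by rewrite gt_eqF.
  have [s [t prim_st]] := primitive_conic_point detn0
    (fun p => @cube_free_entries _ _ p cf (detdvd k)).
  exists (M k *m conic_point s t); split=> //; last by exists (conic_point s t).
  by rewrite MD' !vec3E; ring.
Qed.
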